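(* Assume the Open Coloring Axiom (OCA). Let $\kappa\le2^\omega$, $M$, $(K_\xi)_{\xi<\kappa}$, $\{r_\xi:\xi<\kappa\}$ and splitting functions $f_\xi:M\setminus\{r_\xi\}\to K_\xi$ be as in the definition of a split $M$, and let $K$ be the split $M$ induced by $(f_\xi)_{\xi<\kappa}$. If $K$ is nonmetrizable, then $K$ has a closed subspace admitting a continuous surjection onto a nonmetrizable totally disconnected compact space.
   Context: OCA: for every $X\subseteq\mathbb R$ and every partition $[X]^2=K_0\cup K_1$ with $K_0$ open (in the product topology on $X\times X$), either there is an uncountable $Y\subseteq X$ with $[Y]^2\subseteq K_0$, or $X=\bigcup_{n\in\mathbb N}X_n$ with $[X_n]^2\subseteq K_1$ for all $n$. Split $M$ (definition). Let $\kappa\le 2^\omega$ be a cardinal, $M$ a compact Hausdorff metrizable space with no isolated points, $K_\xi$ ($\xi<\kappa$) compact Hausdorff metrizable spaces, $\{r_\xi:\xi<\kappa\}$ distinct points of $M$, and for each $\xi<\kappa$ let $f_\xi:M\setminus\{r_\xi\}\to K_\xi$ be a continuous function (''splitting function'') such that $f_\xi[U\setminus\{r_\xi\}]$ is dense in $K_\xi$ for every open neighbourhood $U$ of $r_\xi$ in $M$. The split $M$ induced by $(f_\xi)_{\xi<\kappa}$ is the subspace $K$ of $M^{\{*\}}\times\prod_{\xi<\kappa}K_\xi$ consisting of the points $x_{\xi,t}$ ($\xi<\kappa$, $t\in K_\xi$) with $x_{\xi,t}( * )=r_\xi$, $x_{\xi,t}(\xi)=t$, $x_{\xi,t}(\eta)=f_\eta(r_\xi)$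 for $\eta\ne\xi$, and the points $x_r$ ($r\in M\setminus\{r_\xi:\xi<\kappa\}$) with $x_r( * )=r$, $x_r(\xi)=f_\xi(r)$ for all $\xi<\kappa$. *)

(* Defs.v *)
From Stdlib Require Import Reals Classical List.
Open Scope R_scope.
Set Implicit Arguments.

(* A 2-element subset {x,y} of X is coded by a symmetric relation K0 on X
   (pairs x <> y); K1 := [X]^2 \ K0.  K0 open in X x X means: around every
   (x,y) with K0 x y there is a product neighbourhood inside K0. *)
Definition countable_set (Y : R -> Prop) : Prop :=
  exists g : R -> nat, forall x y, Y x -> Y y -> g x = g y -> x = y.

Definition OCA : Prop :=
  forall (X : R -> Prop) (K0 : R -> R -> Prop),
    (forall x y, X x -> X y -> x <> y -> (K0 x y <-> K0 y x)) ->
    (forall x y, X x -> X y -> x <> y -> K0 x y ->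
       exists eps, 0 < eps /\
         forall x' y', X x' -> X y' -> x' <> y' ->
           Rabs (x' - x) < eps -> Rabs (y' - y) < eps -> K0 x' y') ->
    (exists Y : R -> Prop, (forall x, Y x -> X x) /\ ~ countable_set Y /\
        forall x y, Y x -> Y y -> x <> y -> K0 x y)
    \/
    (exists Xn : nat -> R -> Prop,
        (forall x, X x <-> exists n, Xn n x) /\
        (forall n x y, Xn n x -> Xn n y -> x <> y -> ~ K0 x y)).

Record topology (X : Type) (O : (X -> Prop) -> Prop) : Prop := {
  top_full : O (fun _ => True);
  top_inter : forall U V, O U -> O V -> O (fun x => U x /\ V x);
  top_union : forall F : (X -> Prop) -> Prop, (forall U, F U -> O U) ->
                O (fun x => exists U, F U /\ U x) }.

Definition hausdorff (X : Type) (O : (X -> Prop) -> Prop) : Prop :=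
  forall x y, x <> y -> exists U V, O U /\ O V /\ U x /\ V y /\
    forall z, ~ (U z /\ V z).

Definition compact (X : Type) (O : (X -> Prop) -> Prop) : Prop :=
  forall F : (X -> Prop) -> Prop, (forall U, F U -> O U) ->
    (forall x, exists U, F U /\ U x) ->
    exists l : list (X -> Prop), (forall U, In U l -> F U) /\
      forall x, exists U, In U l /\ U x.

Definition is_metric (X : Type) (d : X -> X -> R) : Prop :=
  (forall x y, 0 <= d x y) /\ (forall x y, d x y = 0 <-> x = y) /\
  (forall x y, d x y = d y x) /\ (forall x y z, d x z <= d x y + d y z).

Definition metric_open (X : Type) (d : X -> X -> R) (U : X -> Prop) : Prop :=
  forall x, U x -> exists eps, 0 < eps /\ forall y, d x y < eps -> U y.

Definition metrizable (X : Type) (O : (X -> Prop) -> Prop) : Prop :=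
  exists d : X -> X -> R, is_metric d /\ forall U, O U <-> metric_open d U.

Definition continuous (X Y : Type) (OX : (X -> Prop) -> Prop)
  (OY : (Y -> Prop) -> Prop) (f : X -> Y) : Prop :=
  forall V, OY V -> OX (fun x => V (f x)).

Definition surjective (X Y : Type) (f : X -> Y) : Prop :=
  forall y, exists x, f x = y.

Definition closed (X : Type) (O : (X -> Prop) -> Prop) (C : X -> Prop) : Prop :=
  O (fun x => ~ C x).

Definition dense (X : Type) (O : (X -> Prop) -> Prop) (D : X -> Prop) : Prop :=
  forall U, O U -> (exists x, U x) -> exists x, U x /\ D x.

Definition no_isolated (X : Type) (O : (X -> Prop) -> Prop) : Prop :=
  forall x, ~ O (fun y => y = x).

Definition sub_open (X : Type) (O : (X -> Prop) -> Prop) (A : X -> Prop)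
  : ({x : X | A x} -> Prop) -> Prop :=
  fun W => exists U, O U /\ forall z : {x : X | A x}, W z <-> U (proj1_sig z).

Definition connected_set (X : Type) (O : (X -> Prop) -> Prop) (A : X -> Prop) : Prop :=
  forall U V, O U -> O V -> (forall z, A z -> U z \/ V z) ->
    (forall z, A z -> ~ (U z /\ V z)) ->
    (forall z, A z -> U z) \/ (forall z, A z -> V z).

Definition totally_disconnected (X : Type) (O : (X -> Prop) -> Prop) : Prop :=
  forall A, connected_set O A -> forall x y, A x -> A y -> x = y.

Definition gen_open (X : Type) (S : (X -> Prop) -> Prop) (U : X -> Prop) : Prop :=
  forall x, U x -> exists l : list (X -> Prop),
    (forall V, In V l -> S V) /\ (forall V, In V l -> V x) /\
    forall y, (forall V, In V l -> V y) -> U y.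

Definition prod_subbasis {I M : Type} {K : I -> Type}
  (OM : (M -> Prop) -> Prop) (OK : forall i, (K i -> Prop) -> Prop)
  (V : M * (forall i, K i) -> Prop) : Prop :=
  (exists U, OM U /\ forall p, V p <-> U (fst p)) \/
  (exists i U, OK i U /\ forall p, V p <-> U (snd p i)).

Definition prod_open {I M : Type} {K : I -> Type}
  (OM : (M -> Prop) -> Prop) (OK : forall i, (K i -> Prop) -> Prop) :=
  gen_open (prod_subbasis OM OK).

(* Points of the split M induced by (f_i): either x_{xi,t} (first coordinate
   r xi, coordinate xi arbitrary, coordinate eta <> xi equal to f_eta(r_xi);
   since r is injective, "eta <> xi" is exactly "r xi <> r eta"), or x_r for
   r outside {r_xi}. *)
Definition split_pts {I M : Type} {K : I -> Type} (r : I -> M)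
  (f : forall i, {x : M | x <> r i} -> K i) (p : M * (forall i, K i)) : Prop :=
  (exists xi, fst p = r xi /\
     forall eta (h : r xi <> r eta), snd p eta = f eta (exist _ (r xi) h))
  \/
  ((forall xi, fst p <> r xi) /\
     forall eta (h : fst p <> r eta), snd p eta = f eta (exist _ (fst p) h)).

Definition split_open {I M : Type} {K : I -> Type} (r : I -> M)
  (f : forall i, {x : M | x <> r i} -> K i)
  (OM : (M -> Prop) -> Prop) (OK : forall i, (K i -> Prop) -> Prop) :=
  sub_open (prod_open OM OK) (split_pts r f).
Arguments split_open {I M K} r f OM OK _.

(* Main.v *)
(** Only coordinates whose factor [K i] has two points matter; if there were countably
many of them, the split [K] would be metrizable. For each such [i] take a continuous
[phi i : K i -> R] with values 0 and 1, and for an interval [[p, q]] inside (0, 1) colour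
{i, j} with colour 0 if [phi j (f j (r i))] and [phi i (f i (r j))] both lie off [[p, q]].
This is an open colouring for a second countable topology on the indices. An uncountable
0-homogeneous set [A] gives the closed set [C] of points whose [i]-th coordinates,
for [i] in [A], avoid [phi i]-values in (p, q); thresholding maps [C] onto a compact
subspace of a Cantor cube in which uncountably many coordinates are pairwise distinct.
If OCA gave instead, for each of three disjoint intervals, a countable cover by
1-homogeneous sets, then a common piece could not contain two points [i] and [j], since
two values cannot meet three disjoint intervals; so there would be only countably many
indices. *)

From Stdlib Require Import Reals Lra Lia Classical ClassicalEpsilon List Cantor.
From Stdlib Require Import FunctionalExtensionality PropExtensionality ProofIrrelevance.
Require Import Defs.
Open Scope R_scope.
Set Implicit Arguments.

(** * Choice and extensionality *)

Lemma dep_choice {A : Type} {B : A -> Type} {P : forall a, B a -> Prop} :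
  (forall a, exists b, P a b) -> exists g : forall a, B a, forall a, P a (g a).
Proof.
  intros H.
  exists (fun a => proj1_sig (constructive_indefinite_description _ (H a))).
  intros a; apply proj2_sig.
Qed.

Lemma sig_eq (A : Type) (P : A -> Prop) (x y : {a | P a}) :
  proj1_sig x = proj1_sig y -> x = y.
Proof.
  destruct x as [x hx], y as [y hy]; simpl; intros ->.
  f_equal; apply proof_irrelevance.
Qed.

Lemma open_ext (X : Type) (O : (X -> Prop) -> Prop) (U V : X -> Prop) :
  O U -> (forall x, U x <-> V x) -> O V.
Proof.
  intros HU H; replace V with U; auto.
  extensionality x; apply propositional_extensionality; auto.
Qed.

Definition countable_on (T : Type) (A : T -> Prop) : Prop :=
  exists g : T -> nat, forall x y, A x -> A y -> g x = g y -> x = y.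

(** * Compactness, subspaces and generated topologies *)

Lemma open_list_inter (X T : Type) (O : (X -> Prop) -> Prop) (W : T -> X -> Prop)
  (l : list T) :
  topology O -> (forall t, In t l -> O (W t)) ->
  O (fun x => forall t, In t l -> W t x).
Proof.
  intros HT; induction l as [|a l IH]; simpl; intros H.
  - apply open_ext with (1 := top_full HT); intuition.
  - assert (H1 := H a (or_introl eq_refl)).
    assert (H2 := IH (fun t h => H t (or_intror h))).
    apply open_ext with (1 := top_inter HT _ _ H1 H2).
    intros x; split.
    + intros [h1 h2] t [<-|h]; auto.
    + intros h; split; auto.
Qed.

(* Every compactness argument below is an instance: a property of finite
   families that is monotone in the family and holds locally holds globally. *)
Lemma compact_local_to_global (X T : Type) (O : (X -> Prop) -> Prop) (F : T -> Prop)
  (Q : X -> list T -> Prop) :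
  compact O -> (forall x l l', incl l l' -> Q x l -> Q x l') ->
  (forall x, exists U l, O U /\ U x /\ (forall t, In t l -> F t) /\
     forall y, U y -> Q y l) ->
  exists l, (forall t, In t l -> F t) /\ forall x, Q x l.
Proof.
  intros HC Hmon Hloc.
  destruct (HC (fun U => O U /\ exists l, (forall t, In t l -> F t) /\
                                          forall y, U y -> Q y l))
    as [L [HL Hcov]].
  - tauto.
  - intros x; destruct (Hloc x) as (U & l & h1 & h2 & h3 & h4).
    exists U; split; auto; split; auto; exists l; auto.
  - assert (HG : exists l, (forall t, In t l -> F t) /\
                 forall U y, In U L -> U y -> Q y l).
    { clear Hcov; induction L as [|U L IH].
      - exists nil; simpl; intuition.
      - destruct IH as [l [h1 h2]]; [intros V hV; apply HL; right; auto|].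
        destruct (HL U (or_introl eq_refl)) as [_ [l' [h1' h2']]].
        exists (l ++ l'); split.
        + intros t ht; apply in_app_or in ht; destruct ht; auto.
        + intros V y [<-|hV] hy.
          * apply Hmon with l'; auto; apply incl_appr, incl_refl.
          * apply Hmon with l; [apply incl_appl, incl_refl|eauto]. }
    destruct HG as [l [h1 h2]]; exists l; split; auto.
    intros x; destruct (Hcov x) as [U [h3 h4]]; eauto.
Qed.

Lemma compact_image (X Y : Type) (OX : (X -> Prop) -> Prop) (OY : (Y -> Prop) -> Prop)
  (g : X -> Y) :
  compact OX -> continuous OX OY g -> surjective g -> compact OY.
Proof.
  intros HC Hg Hs F HF Hcov.
  destruct (@compact_local_to_global X _ OX F
              (fun x l => exists V, In V l /\ V (g x)) HC) as [l [h1 h2]].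
  - intros x l l' hl [V [h1 h2]]; exists V; auto.
  - intros x; destruct (Hcov (g x)) as [V [hV hx]].
    exists (fun z => V (g z)), (V :: nil); split; [|split; [|split]].
    + apply Hg; auto.
    + auto.
    + intros t [<-|[]]; auto.
    + intros y hy; exists V; simpl; auto.
  - exists l; split; auto; intros y; destruct (Hs y) as [x <-]; auto.
Qed.

Lemma compact_closed_subspace (X : Type) (O : (X -> Prop) -> Prop) (C : X -> Prop) :
  compact O -> closed O C -> compact (sub_open O C).
Proof.
  intros HC Hcl F HF Hcov.
  destruct (@compact_local_to_global X _ O F
    (fun x l => forall h : C x, exists V, In V l /\ V (exist _ x h)) HC)
    as [l [h1 h2]].
  - intros x l l' hl H h; destruct (H h) as [V [h1 h2]]; exists V; auto.
  - intros x; destruct (classic (C x)) as [h|h].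
    + destruct (Hcov (exist _ x h)) as [V [hV hx]].
      destruct (HF V hV) as [U [hU hUV]].
      exists U, (V :: nil); split; [auto|split; [|split]].
      * apply (hUV (exist _ x h)); auto.
      * intros t [<-|[]]; auto.
      * intros y hy h'; exists V; split; [simpl; auto|].
        apply (hUV (exist _ y h')); auto.
    (* Off [C] nothing has to be covered, so the open complement serves with the empty family. *)
    + exists (fun z => ~ C z), nil; simpl; repeat split; auto.
      * intros t [].
      * intros y hy h'; contradiction.
  - exists l; split; auto; intros [x h]; apply h2.
Qed.

Lemma sub_open_topology (X : Type) (O : (X -> Prop) -> Prop) (C : X -> Prop) :
  topology O -> topology (sub_open O C).
Proof.
  intros HT; split.
  - exists (fun _ => True); split; [apply HT|tauto].
  - intros U V [U' [hU1 hU2]] [V' [hV1 hV2]].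
    exists (fun x => U' x /\ V' x); split; [apply HT; auto|].
    intros z; rewrite hU2, hV2; tauto.
  - intros F HF.
    (* Taking all ambient open sets whose trace belongs to [F] avoids choosing one for each
       member. *)
    exists (fun x => exists U', (O U' /\ exists U, F U /\ forall z, U z <-> U' (proj1_sig z)) /\ U' x).
    split.
    + apply (top_union HT); tauto.
    + intros z; split.
      * intros [U [hU hz]]; destruct (HF U hU) as [U' [h1 h2]].
        exists U'; split; [split; eauto|]; apply h2; auto.
      * intros [U' [[h1 [U [h2 h3]]] h4]]; exists U; split; auto; apply h3; auto.
Qed.

Lemma gen_open_topology (X : Type) (S : (X -> Prop) -> Prop) : topology (gen_open S).
Proof.
  split.
  - intros x _; exists nil; simpl; intuition.
  - intros U V HU HV x [hU hV].
    destruct (HU x hU) as [l [h1 [h2 h3]]], (HV x hV) as [l' [h1' [h2' h3']]].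
    exists (l ++ l'); split; [|split].
    + intros W hW; apply in_app_or in hW; destruct hW as [hW|hW]; auto.
    + intros W hW; apply in_app_or in hW; destruct hW; [apply h2|apply h2']; auto.
    + intros y hy; split; [apply h3|apply h3']; intros W hW; apply hy, in_or_app; auto.
  - intros F HF x [U [hU hx]]; destruct (HF U hU x hx) as [l [h1 [h2 h3]]].
    exists l; split; [|split]; auto; intros; exists U; auto.
Qed.

(** * Countable bases and an obstruction to metrizability *)

Definition countable_base (X : Type) (O : (X -> Prop) -> Prop) (B : nat -> X -> Prop) : Prop :=
  (forall n, O (B n)) /\
  forall U x, O U -> U x -> exists n, B n x /\ forall y, B n y -> U y.

Lemma ball_open (X : Type) (d : X -> X -> R) (c : X) (e : R) :
  is_metric d -> metric_open d (fun y => d c y < e).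
Proof.
  intros (h0 & h1 & h2 & h3) x hx; exists (e - d c x); split; [lra|].
  intros y hy; assert (h := h3 c x y); lra.
Qed.

Lemma inv_S_pos (n : nat) : 0 < / INR (S n).
Proof. apply Rinv_0_lt_compat, lt_0_INR; lia. Qed.

Lemma inv_S_small (e : R) : 0 < e -> exists n, / INR (S n) < e.
Proof.
  intros he; destruct (archimed_cor1 e he) as [n [h1 h2]].
  exists (Nat.pred n); replace (S (Nat.pred n)) with n by lia; auto.
Qed.

Lemma inv_S_le (m n : nat) : (m <= n)%nat -> / INR (S n) <= / INR (S m).
Proof.
  intros h; apply Rinv_le_contravar; [apply lt_0_INR; lia|apply le_INR; lia].
Qed.

(** Compactness gives a finite [1 / (n + 1)]-net for each [n]; the balls of that radius around the
    points of all these nets form a base. *)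
Lemma compact_metrizable_countable_base (X : Type) (O : (X -> Prop) -> Prop) :
  compact O -> metrizable O -> exists B, countable_base O B.
Proof.
  intros HC [d [Hd HO]].
  assert (Hfin : forall n, exists l : list X,
             forall x, exists c, In c l /\ d c x < / INR (S n)).
  { intros n.
    destruct (@compact_local_to_global X X O (fun _ => True)
      (fun x l => exists c, In c l /\ d c x < / INR (S n)) HC) as [l [_ hl]].
    - intros x l l' hl [c [h1 h2]]; exists c; auto.
    - intros x; exists (fun y => d x y < / INR (S n)), (x :: nil); split; [|split; [|split]].
      + apply HO, ball_open, Hd.
      + destruct Hd as (_ & h1 & _); rewrite (proj2 (h1 x x) eq_refl); apply inv_S_pos.
      + auto.
      + intros y hy; exists x; simpl; auto.
    - exists l; auto. }
  destruct (dep_choice Hfin) as [l Hl].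
  (* The code [k] names a net and a position in it; a position past the end gives the empty set. *)
  exists (fun k x => exists c, nth_error (l (fst (of_nat k))) (snd (of_nat k)) = Some c /\
                       d c x < / INR (S (fst (of_nat k)))); split.
  - intros k; apply HO; intros x [c [h1 h2]].
    destruct (@ball_open _ d c (/ INR (S (fst (of_nat k)))) Hd x h2) as [e [he h]].
    exists e; split; eauto.
  - intros U x HU Hx; apply HO in HU.
    destruct (HU x Hx) as [e [he hU]].
    destruct (@inv_S_small (e / 2)) as [n hn]; [lra|].
    destruct (Hl n x) as [c [hc hx]].
    destruct (In_nth_error _ _ hc) as [j hj].
    exists (to_nat (n, j)); rewrite cancel_of_to; simpl fst; simpl snd; split; eauto.
    intros y [c' [h1 h2]]; rewrite hj in h1; injection h1 as <-.
    apply hU; destruct Hd as (_ & _ & hs & ht).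
    assert (h := ht x c y); rewrite (hs x c) in h; lra.
Qed.

(** With a countable base, code each [i] in [A] by a basic set inside [S i] around [y1] and one
    outside [S i] around [y0]. If distinct [i] and [j] had the same code, then [S i] would separate
    the two points chosen for [j], so the coding is injective on [A]. *)
Lemma not_metrizable_of_uncountable_independent (I Y : Type) (OY : (Y -> Prop) -> Prop)
  (A : I -> Prop) (S : I -> Y -> Prop) :
  compact OY ->
  (forall i, A i -> OY (S i) /\ OY (fun y => ~ S i y)) ->
  (forall i, A i -> exists y1 y0, S i y1 /\ ~ S i y0 /\
     forall j, A j -> j <> i -> (S j y1 <-> S j y0)) ->
  ~ countable_on A -> ~ metrizable OY.
Proof.
  intros HC HS Hpt HA HM; apply HA.
  destruct (compact_metrizable_countable_base HC HM) as [B [_ HB]].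
  assert (H : forall i, exists k, A i -> exists y1 y0,
            (B (fst (of_nat k)) y1 /\ B (snd (of_nat k)) y0) /\
            (forall y, B (fst (of_nat k)) y -> S i y) /\
            (forall y, B (snd (of_nat k)) y -> ~ S i y) /\
            forall j, A j -> j <> i -> (S j y1 <-> S j y0)).
  { intros i; destruct (classic (A i)) as [hi|hi]; [|exists 0%nat; tauto].
    destruct (Hpt i hi) as (y1 & y0 & h1 & h0 & hj), (HS i hi) as [o1 o0].
    destruct (HB _ _ o1 h1) as [n [hn hn']], (HB _ _ o0 h0) as [m [hm hm']].
    exists (to_nat (n, m)); rewrite cancel_of_to; simpl; intros _.
    exists y1, y0; auto. }
  destruct (dep_choice H) as [g Hg]; exists g.
  intros i j hi hj hij; apply NNPP; intros hne.
  destruct (Hg i hi) as (_ & _ & _ & Hi1 & Hi0 & _).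
  destruct (Hg j hj) as (y1 & y0 & [h1 h0] & _ & _ & Hj).
  rewrite hij in Hi1, Hi0.
  apply (Hi0 y0 h0), (Hj i hi hne), Hi1, h1.
Qed.

(** * Bit sequences as reals, and OCA for second countable topologies *)

Fixpoint ternary_sum (s : nat -> bool) (n : nat) : R :=
  match n with
  | O => 0
  | S m => ternary_sum s m + (if s m then 1 else 0) * (/ 3) ^ m
  end.

Lemma ternary_pow_pos (n : nat) : 0 < (/ 3) ^ n.
Proof. apply pow_lt; lra. Qed.

(** The upper bound is the geometric sum of [(/ 3) ^ m] for [n <= m < k + n]; keeping its last term
    exact makes the induction close. *)
Lemma ternary_sum_tail (s : nat -> bool) (n k : nat) :
  ternary_sum s n <= ternary_sum s (k + n) <=
  ternary_sum s n + 3 / 2 * (/ 3) ^ n - 3 / 2 * (/ 3) ^ (k + n).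
Proof.
  induction k as [|k IH]; simpl; [lra|].
  assert (h := ternary_pow_pos (k + n)); destruct (s (k + n)%nat); lra.
Qed.

Lemma ternary_real_exists (s : nat -> bool) :
  exists e, forall n, ternary_sum s n <= e <= ternary_sum s n + 3 / 2 * (/ 3) ^ n.
Proof.
  destruct (completeness (fun v => exists n, v = ternary_sum s n)) as [e [h1 h2]].
  - exists (3 / 2); intros v [n ->].
    assert (h := ternary_sum_tail s 0 n); rewrite Nat.add_0_r in h; simpl in h.
    assert (h' := ternary_pow_pos n); lra.
  - exists 0, 0%nat; reflexivity.
  - exists e; intros n; split; [apply h1; eauto|].
    apply h2; intros v [m ->].
    destruct (Nat.le_gt_cases n m) as [h|h].
    + assert (H := ternary_sum_tail s n (m - n)).
      replace (m - n + n)%nat with m in H by lia.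
      assert (h' := ternary_pow_pos m); lra.
    + assert (H := ternary_sum_tail s m (n - m)).
      replace (n - m + m)%nat with n in H by lia.
      assert (h' := ternary_pow_pos n); lra.
Qed.

Lemma ternary_sum_ext (s t : nat -> bool) (n : nat) :
  (forall k, (k < n)%nat -> s k = t k) -> ternary_sum s n = ternary_sum t n.
Proof.
  induction n as [|n IH]; simpl; intros H; auto.
  rewrite IH, (H n); auto with arith.
Qed.

(** If [s] and [t] first differ at [k], the larger value is at least [(/ 3) ^ k] above the common
    partial sum and the smaller at most [/ 2 * (/ 3) ^ k] above it, since its tail starts at
    [k + 1]. The gap is thus at least [/ 2 * (/ 3) ^ k]. *)
Lemma cantor_embedding :
  exists e : (nat -> bool) -> R, forall s t n,
    Rabs (e s - e t) < / 2 * (/ 3) ^ n -> forall k, (k <= n)%nat -> s k = t k.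
Proof.
  destruct (dep_choice ternary_real_exists) as [e He]; exists e.
  intros s t n hst k; induction k as [k IH] using (well_founded_induction Wf_nat.lt_wf).
  intros hk; assert (E : ternary_sum s k = ternary_sum t k).
  { apply ternary_sum_ext; intros j hj; apply IH; lia. }
  assert (P : (/ 3) ^ n <= (/ 3) ^ k).
  { replace n with ((n - k) + k)%nat by lia; rewrite pow_add.
    rewrite <- (Rmult_1_l ((/ 3) ^ k)) at 2.
    apply Rmult_le_compat_r; [left; apply ternary_pow_pos|].
    rewrite <- (pow1 (n - k)); apply pow_incr; lra. }
  assert (Hs := He s (S k)); assert (Ht := He t (S k)); simpl in Hs, Ht.
  apply Rabs_def2 in hst.
  destruct (s k), (t k); auto; exfalso; lra.
Qed.

(* The bits [P n i] span a second countable topology on [I], transported to a set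
   of reals by the Cantor embedding; [E] is required to be open for it. *)
Lemma OCA_second_countable (I : Type) (N : I -> Prop) (P : nat -> I -> Prop)
  (E : I -> I -> Prop) :
  OCA ->
  (forall i j, N i -> N j -> (forall n, P n i <-> P n j) -> i = j) ->
  (forall i j, E i j -> E j i) ->
  (forall i j, N i -> N j -> i <> j -> E i j -> exists n, forall i' j',
     N i' -> N j' -> i' <> j' ->
     (forall k, (k <= n)%nat -> (P k i <-> P k i')) ->
     (forall k, (k <= n)%nat -> (P k j <-> P k j')) -> E i' j') ->
  (exists A : I -> Prop, (forall i, A i -> N i) /\ ~ countable_on A /\
     forall i j, A i -> A j -> i <> j -> E i j) \/
  (exists h : I -> nat, forall i j, N i -> N j -> i <> j -> h i = h j -> ~ E i j).
Proof.
  intros HO Hsep Hsym Hopen.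
  destruct cantor_embedding as [c Hc].
  pose (bit := fun i n => if excluded_middle_informative (P n i) then true else false).
  assert (Hbit : forall i j n, bit i n = bit j n -> (P n i <-> P n j)).
  { intros i j n; unfold bit.
    destruct (excluded_middle_informative (P n i)), (excluded_middle_informative (P n j));
      intuition discriminate. }
  pose (e := fun i => c (bit i)).
  assert (Hnear : forall i j n, Rabs (e j - e i) < / 2 * (/ 3) ^ n ->
            forall k, (k <= n)%nat -> (P k i <-> P k j)).
  { intros i j n h k hk; symmetry; apply Hbit; exact (Hc _ _ n h k hk). }
  assert (Hinj : forall i j, N i -> N j -> e i = e j -> i = j).
  { intros i j hi hj hij; apply Hsep; auto; intros n; apply (Hnear i j n); auto.
    rewrite hij, Rminus_diag, Rabs_R0; assert (h := ternary_pow_pos n); lra. }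
  destruct (HO (fun x => exists i, N i /\ x = e i)
    (fun x y => exists i j, N i /\ N j /\ x = e i /\ y = e j /\ E i j))
    as [(Y & hY & hunc & hhom)|(Xn & hX & hhom)].
  - intros x y _ _ _; split; intros (i & j & h1 & h2 & h3 & h4 & h5);
      exists j, i; repeat split; auto.
  - intros x y _ _ hxy (i & j & hi & hj & -> & -> & hE).
    destruct (Hopen i j) as [n hn]; auto; [intros ->; auto|].
    exists (/ 2 * (/ 3) ^ n); split; [assert (h := ternary_pow_pos n); lra|].
    intros x' y' [i' [hi' ->]] [j' [hj' ->]] hne h1 h2; exists i', j'; repeat split; auto.
    apply hn; auto; [intros ->; auto| |]; apply Hnear; auto.
  - left; exists (fun i => N i /\ Y (e i)); split; [tauto|split].
    + intros [g hg]; apply hunc.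
      (* A numbering of the indices would number [Y] through [e]; the value 0 off [Y] is a dummy. *)
      assert (H : forall x, exists n, Y x -> exists i, N i /\ x = e i /\ n = g i).
      { intros x; destruct (classic (Y x)) as [h|h]; [|exists 0%nat; tauto].
        destruct (hY x h) as [i [hi ->]]; exists (g i); intros _; exists i; auto. }
      destruct (dep_choice H) as [u hu]; exists u; intros x y hx hy huxy.
      destruct (hu x hx) as (i & hi & -> & hgi), (hu y hy) as (j & hj & -> & hgj).
      f_equal; apply hg; auto; congruence.
    + intros i j [hi hyi] [hj hyj] hne.
      destruct (hhom (e i) (e j)) as (i' & j' & h1 & h2 & h3 & h4 & h5); auto.
      apply Hinj in h3, h4; auto; subst; auto.
  - right.
    (* The pieces [Xn] may overlap, so one piece is chosen for each index. *)
    assert (H : forall i, exists n, N i -> Xn n (e i)).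
    { intros i; destruct (classic (N i)) as [h|h]; [|exists 0%nat; tauto].
      destruct (proj1 (hX (e i))) as [n hn]; eauto. }
    destruct (dep_choice H) as [h Hh]; exists h; intros i j hi hj hne hij hE.
    apply (hhom (h i) (e i) (e j)); auto.
    + rewrite hij; auto.
    + exists i, j; repeat split; auto.
Qed.

(** * Real-valued functions and totally disconnected images *)

Definition real_continuous (X : Type) (O : (X -> Prop) -> Prop) (phi : X -> R) : Prop :=
  forall c, O (fun x => phi x < c) /\ O (fun x => c < phi x).

(** For distinct [a] and [b] the normalised distance [d a x / d a b] works; with at most one point a
    constant does. *)
Lemma metrizable_separating_function (X : Type) (O : (X -> Prop) -> Prop) :
  metrizable O -> exists phi : X -> R, real_continuous O phi /\
    ((exists a b : X, a <> b) -> exists a b, phi a = 0 /\ phi b = 1).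
Proof.
  intros [d [(h0 & h1 & h2 & h3) HO]].
  destruct (classic (exists a b : X, a <> b)) as [(a & b & hab)|hno].
  - assert (hp : 0 < d a b).
    { destruct (h0 a b) as [h|h]; auto; destruct hab; apply h1; auto. }
    assert (Hlt : forall x c, d a x / d a b < c <-> d a x < c * d a b).
    { intros x c; split; intros h.
      - apply (Rmult_lt_compat_r (d a b)) in h; auto.
        unfold Rdiv in h; rewrite Rmult_assoc, Rinv_l in h; lra.
      - apply (Rmult_lt_reg_r (d a b)); auto.
        unfold Rdiv; rewrite Rmult_assoc, Rinv_l; lra. }
    assert (Hgt : forall x c, c < d a x / d a b <-> c * d a b < d a x).
    { intros x c; split; intros h.
      - apply (Rmult_lt_compat_r (d a b)) in h; auto.
        unfold Rdiv in h; rewrite Rmult_assoc, Rinv_l in h; lra.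
      - apply (Rmult_lt_reg_r (d a b)); auto.
        unfold Rdiv; rewrite Rmult_assoc, Rinv_l; lra. }
    exists (fun x => d a x / d a b); split.
    + intros c; split; apply HO; intros x hx.
      * apply Hlt in hx; exists (c * d a b - d a x); split; [lra|].
        intros y hy; apply Hlt; assert (h := h3 a x y); lra.
      * apply Hgt in hx; exists (d a x - c * d a b); split; [lra|].
        intros y hy; apply Hgt; assert (h := h3 a y x); rewrite (h2 y x) in h; lra.
    + intros _; exists a, b; split.
      * rewrite (proj2 (h1 a a) eq_refl); unfold Rdiv; ring.
      * field; lra.
  - exists (fun _ => 0); split; [|tauto].
    intros c; split; apply HO; intros x hx; exists 1; split; auto; lra.
Qed.

Lemma hausdorff_point_complement_open (X : Type) (O : (X -> Prop) -> Prop) :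
  topology O -> hausdorff O -> forall x, O (fun y => y <> x).
Proof.
  intros HT HH x.
  apply open_ext with (1 := top_union HT (fun U => O U /\ ~ U x) (fun U h => proj1 h)).
  intros y; split.
  - intros [U [[_ h1] h2]] ->; auto.
  - intros hy; destruct (HH y x hy) as (U & V & h1 & h2 & h3 & h4 & h5).
    exists U; repeat split; auto; intros h; apply (h5 x); auto.
Qed.

(* [Y] is the image of [X] under the characteristic functions [S i], with the
   quotient topology; each [S i] is clopen on [X], so they separate [Y]. *)
Lemma totally_disconnected_image (I X : Type) (O : (X -> Prop) -> Prop)
  (A : I -> Prop) (S : I -> X -> Prop) :
  topology O -> compact O ->
  (forall i, A i -> O (S i) /\ O (fun x => ~ S i x)) ->
  (forall i, A i -> exists x1 x0, S i x1 /\ ~ S i x0 /\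
     forall j, A j -> j <> i -> (S j x1 <-> S j x0)) ->
  ~ countable_on A ->
  exists (Y : Type) (OY : (Y -> Prop) -> Prop),
    topology OY /\ compact OY /\ hausdorff OY /\ ~ metrizable OY /\
    totally_disconnected OY /\
    exists g : X -> Y, continuous O OY g /\ surjective g.
Proof.
  intros HT HC HS Hpt HA.
  (* Coordinates outside [A] are made constantly false, so that only clopen ones distinguish points
     of [Y]. *)
  pose (h := fun x i => A i /\ S i x).
  pose (g := fun x => exist (fun y => exists x, y = h x) (h x) (ex_intro _ x eq_refl)).
  pose (OY := fun V : {y | exists x, y = h x} -> Prop => O (fun x => V (g x))).
  assert (Hg : continuous O OY g) by (intros V hV; exact hV).
  assert (Hs : surjective g).
  { intros [y [x ->]]; exists x; apply sig_eq; reflexivity. }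
  assert (HCY : compact OY) by (apply compact_image with (1 := HC) (2 := Hg); auto).
  assert (Hclopen : forall i, A i -> OY (fun y => proj1_sig y i) /\
                                     OY (fun y => ~ proj1_sig y i)).
  { intros i hi; destruct (HS i hi) as [h1 h2]; split.
    - apply open_ext with (1 := h1); intros x; simpl; unfold h; tauto.
    - apply open_ext with (1 := h2); intros x; simpl; unfold h; tauto. }
  assert (Hsep : forall y y' : {y | exists x, y = h x}, y <> y' ->
            exists i, A i /\ (proj1_sig y i /\ ~ proj1_sig y' i \/
                              ~ proj1_sig y i /\ proj1_sig y' i)).
  { intros y y' hne; apply NNPP; intros hno; apply hne, sig_eq.
    extensionality i; apply propositional_extensionality.
    assert (H : forall z : {y | exists x, y = h x}, proj1_sig z i -> A i).
    { intros [z [x ->]]; simpl; unfold h; tauto. }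
    assert (H1 := H y); assert (H2 := H y').
    destruct (classic (proj1_sig y i)), (classic (proj1_sig y' i)); try tauto;
      destruct hno; exists i; tauto. }
  exists {y | exists x, y = h x}, OY; split; [|split; [|split; [|split; [|split]]]].
  - split.
    + apply HT.
    + intros U V; apply HT.
    + intros F HF; unfold OY.
      apply open_ext with (1 := top_union HT
        (fun W => exists U, F U /\ W = fun x => U (g x))
        (fun W (hW : exists U, F U /\ W = fun x => U (g x)) =>
           match hW with ex_intro _ U (conj h1 e) => eq_ind_r O (HF U h1) e end)).
      intros x; split.
      * intros [W [[U [h1 ->]] h2]]; exists U; auto.
      * intros [U [h1 h2]]; exists (fun x => U (g x)); split; auto; exists U; auto.
  - auto.
  - intros y y' hne; destruct (Hsep y y' hne) as [i [hi [hy|hy]]];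
      destruct (Hclopen i hi) as [o1 o2].
    + exists (fun y => proj1_sig y i), (fun y => ~ proj1_sig y i); repeat split; auto; tauto.
    + exists (fun y => ~ proj1_sig y i), (fun y => proj1_sig y i); repeat split; auto; tauto.
  - apply not_metrizable_of_uncountable_independent with
      (A := A) (S := fun i y => proj1_sig y i); auto.
    intros i hi; destruct (Hpt i hi) as (x1 & x0 & h1 & h0 & hj).
    exists (g x1), (g x0); simpl; unfold h; split; [auto|split; [tauto|]].
    intros j hAj hne; specialize (hj j hAj hne); tauto.
  - intros B HB y y' hy hy'; apply NNPP; intros hne.
    destruct (Hsep y y' hne) as [i [hi Hi]]; destruct (Hclopen i hi) as [o1 o2].
    destruct (HB _ _ o1 o2) as [H|H].
    + intros z _; apply classic.
    + intros z _; tauto.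
    + assert (h1 := H y hy); assert (h2 := H y' hy'); tauto.
    + assert (h1 := H y hy); assert (h2 := H y' hy'); tauto.
  - exists g; auto.
Qed.

(** * Points, neighbourhoods, compactness and metrizability of the split space *)

Section Split.
Unset Implicit Arguments.
Variables (I M : Type) (OM : (M -> Prop) -> Prop) (K : I -> Type)
  (OK : forall i, (K i -> Prop) -> Prop) (r : I -> M)
  (f : forall i, {x : M | x <> r i} -> K i).
Hypothesis r_inj : forall i j, r i = r j -> i = j.
Hypothesis f_cont : forall i, continuous (sub_open OM (fun x => x <> r i)) (OK i) (f i).
Hypothesis OM_top : topology OM.
Hypothesis OM_point_closed : forall m, OM (fun x => x <> m).
Hypothesis OK_top : forall i, topology (OK i).
Hypothesis OK_metrizable : forall i, metrizable (OK i).
Variable phi : forall i, K i -> R.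
Hypothesis phi_cont : forall i, real_continuous (OK i) (phi i).
Set Implicit Arguments.

Local Notation split_space := {p | split_pts r f p}.
Definition base (z : split_space) : M := fst (proj1_sig z).
Definition coord (i : I) (z : split_space) : K i := snd (proj1_sig z) i.

(** Both clauses of [split_pts] force this value; later arguments need not distinguish the two kinds
    of points. *)
Lemma split_coord (z : split_space) (i : I) (h : base z <> r i) :
  coord i z = f i (exist _ (base z) h).
Proof.
  destruct z as [[m s] H]; unfold base, coord in *; simpl in *.
  destruct H as [[xi [h1 h2]]|[h1 h2]]; simpl in *; [subst m|]; auto.
Qed.

Lemma split_fiber_point (xi : I) (t : K xi) :
  exists z : split_space, base z = r xi /\ coord xi z = t.
Proof.
  (* The free value [t] is transported to coordinate [xi]; every other coordinate is forced by
     [f]. *)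
  pose (s := fun eta => match excluded_middle_informative (xi = eta) with
     | left e => eq_rect xi K t eta e
     | right ne => f eta (exist (fun x => x <> r eta) (r xi) (fun h => ne (r_inj xi eta h)))
     end).
  assert (H : split_pts r f (r xi, s)).
  { left; exists xi; split; auto; intros eta h; unfold s; simpl.
    destruct (excluded_middle_informative (xi = eta)) as [e|ne].
    - subst; contradiction.
    - do 2 f_equal; apply proof_irrelevance. }
  exists (exist _ _ H); split; auto; unfold coord, s; simpl.
  destruct (excluded_middle_informative (xi = xi)) as [e|ne]; [|contradiction].
  rewrite (proof_irrelevance _ e eq_refl); reflexivity.
Qed.

Lemma split_point_over (m : M) : (forall xi, m <> r xi) ->
  exists z : split_space, base z = m.
Proof.
  intros Hm.
  assert (H : split_pts r f (m, fun eta => f eta (exist _ m (Hm eta)))).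
  { right; split; auto; intros eta h; simpl; do 2 f_equal; apply proof_irrelevance. }
  exists (exist _ _ H); reflexivity.
Qed.

Lemma coord_continuous (i : I) : continuous (split_open r f OM OK) (OK i) (coord i).
Proof.
  intros U HU; exists (fun p => U (snd p i)); split; [|reflexivity].
  intros p hp; exists ((fun p => U (snd p i)) :: nil); split; [|split].
  - intros V [<-|[]]; right; exists i, U; split; auto; reflexivity.
  - intros V [<-|[]]; auto.
  - intros q hq; apply hq; left; auto.
Qed.

Lemma split_open_topology : topology (split_open r f OM OK).
Proof. apply sub_open_topology, gen_open_topology. Qed.

(** Off the fibre over [r i], coordinate [i] is a continuous function of the base, so an open
    condition on it becomes one on the base. *)
Lemma coord_local (i : I) (U : K i -> Prop) (z : split_space) :
  OK i U -> U (coord i z) -> base z <> r i ->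
  exists W, OM W /\ W (base z) /\ forall y, W (base y) -> U (coord i y).
Proof.
  intros HU Hz Hne; destruct (@f_cont i U HU) as [W [HW hW]].
  exists (fun m => W m /\ m <> r i); split; [|split].
  - apply OM_top; auto.
  - split; auto; apply (hW (exist (fun x => x <> r i) _ Hne)); rewrite <- (split_coord z Hne); auto.
  - intros y [h1 h2]; rewrite (split_coord y h2); apply hW; exact h1.
Qed.

(* Over a neighbourhood of [r xi], only the coordinate [xi] and the base matter. *)
Lemma split_nbhd_fiber (xi : I) (U : split_space -> Prop) (z : split_space) :
  split_open r f OM OK U -> U z -> base z = r xi ->
  exists W V, OM W /\ W (r xi) /\ OK xi V /\ V (coord xi z) /\
    forall y, W (base y) -> V (coord xi y) -> U y.
Proof.
  intros [U' [HU' hU]] Hz Hb.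
  destruct (HU' (proj1_sig z)) as [l [hl [hz hlU]]]; [apply hU; auto|].
  assert (H : exists W V, OM W /\ W (r xi) /\ OK xi V /\ V (coord xi z) /\
    forall y, W (base y) -> V (coord xi y) -> forall S, In S l -> S (proj1_sig y)).
  { clear hlU; induction l as [|S l IH].
    - exists (fun _ => True), (fun _ => True); repeat split; auto;
        [apply OM_top|apply OK_top|intros y _ _ S []].
    - destruct IH as (W & V & h1 & h2 & h3 & h4 & h5).
      { intros T hT; apply hl; right; auto. }
      { intros T hT; apply hz; right; auto. }
      assert (hS := hz S (or_introl eq_refl)).
      destruct (hl S (or_introl eq_refl)) as [[T [hT hST]]|[i [T [hT hST]]]];
        apply hST in hS.
      + exists (fun m => T m /\ W m), V; split; [apply OM_top; auto|].
        split; [split; auto; rewrite <- Hb; auto|split; [auto|split; [auto|]]].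
        intros y [hT' hW] hV S' [<-|hS']; [apply hST; auto|apply h5; auto].
      (* A condition on coordinate [xi] shrinks [V]; one on any other coordinate is absorbed into
         [W]. *)
      + destruct (classic (xi = i)) as [<-|hne].
        * exists W, (fun t => T t /\ V t); split; [auto|split; [auto|]].
          split; [apply OK_top; auto|split; [split; auto|]].
          intros y hW [hT' hV] S' [<-|hS']; [apply hST; auto|apply h5; auto].
        * destruct (@coord_local i T z) as (W' & k1 & k2 & k3); auto.
          { rewrite Hb; auto. }
          exists (fun m => W' m /\ W m), V; split; [apply OM_top; auto|].
          split; [split; auto; rewrite <- Hb; auto|split; [auto|split; [auto|]]].
          intros y [hW' hW] hV S' [<-|hS']; [apply hST, k3; auto|apply h5; auto]. }
  destruct H as (W & V & h1 & h2 & h3 & h4 & h5).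
  exists W, V; repeat split; auto; intros y hW hV; apply hU, hlU, h5; auto.
Qed.

(** No coordinate is free over such a base point, so [coord_local] moves every subbasic condition to
    the base. *)
Lemma split_nbhd_point (U : split_space -> Prop) (z : split_space) :
  split_open r f OM OK U -> U z -> (forall xi, base z <> r xi) ->
  exists W, OM W /\ W (base z) /\ forall y, W (base y) -> U y.
Proof.
  intros [U' [HU' hU]] Hz Hb.
  destruct (HU' (proj1_sig z)) as [l [hl [hz hlU]]]; [apply hU; auto|].
  assert (H : exists W, OM W /\ W (base z) /\
    forall y, W (base y) -> forall S, In S l -> S (proj1_sig y)).
  { clear hlU; induction l as [|S l IH].
    - exists (fun _ => True); split; [apply OM_top|split; [auto|intros y _ S []]].
    - destruct IH as (W & h1 & h2 & h5).
      { intros T hT; apply hl; right; auto. }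
      { intros T hT; apply hz; right; auto. }
      assert (hS := hz S (or_introl eq_refl)).
      destruct (hl S (or_introl eq_refl)) as [[T [hT hST]]|[i [T [hT hST]]]];
        apply hST in hS.
      + exists (fun m => T m /\ W m); split; [apply OM_top; auto|split; [split; auto|]].
        intros y [hT' hW] S' [<-|hS']; [apply hST; auto|apply (h5 y); auto].
      + destruct (@coord_local i T z) as (W' & k1 & k2 & k3); auto.
        exists (fun m => W' m /\ W m); split; [apply OM_top; auto|split; [split; auto|]].
        intros y [hW' hW] S' [<-|hS']; [apply hST, k3; auto|apply (h5 y); auto]. }
  destruct H as (W & h1 & h2 & h5).
  exists W; repeat split; auto; intros y hW; apply hU, hlU, h5; auto.
Qed.

(* The fibres of [base] are compact (a point or a copy of some [K xi]) and [base]
   is a closed map, so compactness of [M] lifts. *)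
Lemma split_compact :
  compact OM -> (forall i, compact (OK i)) -> compact (split_open r f OM OK).
Proof.
  intros HM HK F HF Hcov.
  destruct (@compact_local_to_global M _ OM F
    (fun m l => forall y, base y = m -> exists U, In U l /\ U y) HM) as [l [h1 h2]].
  - intros m l l' hl H y hy; destruct (H y hy) as [U [h1 h2]]; exists U; auto.
  - intros m; destruct (classic (exists xi, m = r xi)) as [[xi ->]|Hm].
    (* A tube argument: each covering set [U] is paired with a base neighbourhood [W] of [r xi], and
       the finitely many [W] are then intersected. *)
    + destruct (@compact_local_to_global (K xi) ((M -> Prop) * (split_space -> Prop)) (OK xi)
        (fun p => OM (fst p) /\ fst p (r xi) /\ F (snd p))
        (fun t l => exists p, In p l /\ forall y, fst p (base y) -> coord xi y = t -> snd p y)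
        (HK xi)) as [l [h1 h2]].
      * intros t l l' hl [p [h1 h2]]; exists p; auto.
      * intros t; destruct (split_fiber_point t) as [z [hz <-]].
        destruct (Hcov z) as [U [hU Uz]].
        destruct (@split_nbhd_fiber xi U z (HF U hU) Uz hz) as (W & V & k1 & k2 & k3 & k4 & k5).
        exists V, ((W, U) :: nil); split; [auto|split; [auto|split]].
        -- intros p [<-|[]]; simpl; auto.
        -- intros t ht; exists (W, U); simpl; split; auto.
           intros y hy <-; auto.
      * exists (fun m => forall p, In p l -> fst p m), (map snd l).
        split; [|split; [|split]].
        -- apply open_list_inter; auto; intros p hp; apply h1; auto.
        -- intros p hp; apply h1; auto.
        -- intros U hU; apply in_map_iff in hU; destruct hU as [p [<- hp]]; apply h1; auto.
        -- intros m hm y <-; destruct (h2 (coord xi y)) as [p [hp hy]].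
           exists (snd p); split; [apply in_map; auto|auto].
    + assert (Hm' : forall xi, m <> r xi) by (intros xi e; apply Hm; eauto).
      destruct (split_point_over Hm') as [z hz].
      destruct (Hcov z) as [U [hU Uz]].
      destruct (@split_nbhd_point U z (HF U hU) Uz) as (W & k1 & k2 & k3).
      { rewrite hz; auto. }
      exists W, (U :: nil); split; [auto|split; [rewrite <- hz; auto|split]].
      * intros V [<-|[]]; auto.
      * intros m' hm' y <-; exists U; simpl; auto.
  - exists l; split; auto; intros y; apply (h2 (base y)); auto.
Qed.

(* The coordinates with at most one value are ignored; the others enter through
   the sup metric with the [n]-th one truncated at [1 / (n + 1)]. *)
Lemma split_metrizable :
  metrizable OM -> countable_on (fun i => exists a b : K i, a <> b) ->
  metrizable (split_open r f OM OK).
Proof.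
  intros [dM [HdM HOM]] [g Hg].
  destruct (dep_choice OK_metrizable) as [d Hd].
  pose (N := fun i => exists a b : K i, a <> b).
  pose (c := fun i (x y : split_space) => Rmin (d i (coord i x) (coord i y)) (/ INR (S (g i)))).
  pose (E := fun x y v => v = dM (base x) (base y) \/ exists i, N i /\ v = c i x y).
  assert (HE : forall x y, exists s, is_lub (E x y) s).
  { intros x y; destruct (completeness (E x y)) as [s hs]; [| |eauto].
    (* Every truncated distance is at most 1. *)
    - exists (dM (base x) (base y) + 1); intros v hv.
      assert (h0 := proj1 HdM (base x) (base y)).
      destruct hv as [->|[i [_ ->]]]; [lra|].
      unfold c; assert (h := Rmin_r (d i (coord i x) (coord i y)) (/ INR (S (g i)))).
      assert (h' := inv_S_le (Nat.le_0_l (g i))); simpl INR in h' at 2; lra.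
    - eexists; left; reflexivity. }
  pose (D := fun x y => proj1_sig (constructive_indefinite_description _ (HE x y))).
  assert (HD : forall x y, is_lub (E x y) (D x y)) by (intros; apply proj2_sig).
  clearbody D; clear HE.
  assert (DM : forall x y, dM (base x) (base y) <= D x y).
  { intros x y; apply HD; left; reflexivity. }
  assert (Dc : forall x y i, N i -> c i x y <= D x y).
  { intros x y i hi; apply HD; right; eauto. }
  assert (Dle : forall x y b, dM (base x) (base y) <= b -> (forall i, N i -> c i x y <= b) ->
             D x y <= b).
  { intros x y b h1 h2; apply HD; intros v [->|[i [hi ->]]]; auto. }
  assert (Htriv : forall i x y, ~ N i -> coord i x = coord i y).
  { intros i x y hi; apply NNPP; intros h; apply hi; unfold N; eauto. }
  destruct HdM as (M0 & M1 & M2 & M3).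
  exists D; split; [split; [|split; [|split]]|].
  - intros x y; assert (h := DM x y); assert (h' := M0 (base x) (base y)); lra.
  - intros x y; split.
    + intros h; apply sig_eq, injective_projections.
      * apply M1; apply Rle_antisym; [rewrite <- h; apply DM|apply M0].
      * apply functional_extensionality_dep; intros i; fold (coord i x) (coord i y).
        destruct (classic (N i)) as [hi|hi]; [|apply Htriv; auto].
        destruct (Hd i) as [(K0 & K1 & _) _]; apply K1, Rle_antisym; [|apply K0].
        assert (h' := Dc x y i hi); unfold c in h'; assert (hp := inv_S_pos (g i)).
        revert h'; apply Rmin_case; lra.
    + intros ->; apply Rle_antisym.
      * apply Dle; [right; apply M1; auto|].
        intros i hi; destruct (Hd i) as [(K0 & K1 & _) _].
        unfold c; rewrite (proj2 (K1 _ _) eq_refl); apply Rmin_l.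
      * assert (h := DM y y); assert (h' := M0 (base y) (base y)); lra.
  - assert (Hs : forall x y, D x y <= D y x).
    { intros x y; apply Dle; [rewrite M2; apply DM|].
      intros i hi; destruct (Hd i) as [(_ & _ & K2 & _) _].
      unfold c; rewrite K2; apply (Dc y x i hi). }
    intros x y; apply Rle_antisym; auto.
  - intros x y z; apply Dle.
    + assert (h1 := M3 (base x) (base y) (base z)); assert (h2 := DM x y).
      assert (h3 := DM y z); lra.
    + intros i hi; assert (h1 := Dc x y i hi); assert (h2 := Dc y z i hi).
      destruct (Hd i) as [(K0 & _ & _ & K3) _].
      apply Rle_trans with (c i x y + c i y z); [|lra]; clear h1 h2; unfold c.
      assert (h1 := K3 (coord i x) (coord i y) (coord i z)); assert (hp := inv_S_pos (g i)).
      assert (h2 := K0 (coord i x) (coord i y)); assert (h3 := K0 (coord i y) (coord i z)).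
      unfold Rmin; repeat destruct Rle_dec; lra.
  - intros U; split.
    + intros [U' [HU' hU]] x hx.
      destruct (HU' (proj1_sig x)) as [l [hl [hz hlU]]]; [apply hU; auto|].
      assert (H : exists eps, 0 < eps /\ forall y, D x y < eps ->
                    forall S, In S l -> S (proj1_sig y)).
      { clear hlU; induction l as [|S l IH].
        - exists 1; split; [lra|intros y _ S []].
        - destruct IH as (e & he & h5).
          { intros T hT; apply hl; right; auto. }
          { intros T hT; apply hz; right; auto. }
          assert (H : exists e', 0 < e' /\ forall y, D x y < e' -> S (proj1_sig y)).
          { assert (hS := hz S (or_introl eq_refl)).
            destruct (hl S (or_introl eq_refl)) as [[T [hT hST]]|[i [T [hT hST]]]];
              apply hST in hS.
            - destruct (proj1 (HOM T) hT _ hS) as [e' [he' h]].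
              exists e'; split; auto; intros y hy; apply hST, h.
              apply Rle_lt_trans with (D x y); [apply DM|auto].
            - destruct (classic (N i)) as [hi|hi].
              + destruct (proj1 (proj2 (Hd i) T) hT _ hS) as [e' [he' h]].
                assert (hp := inv_S_pos (g i)).
                (* Below the truncation level the truncated distance is the true one. *)
                exists (Rmin e' (/ INR (Datatypes.S (g i)))); split; [apply Rmin_pos; auto|].
                intros y hy; apply hST, h.
                assert (hc := Dc x y i hi); unfold c in hc.
                assert (ha := Rmin_l e' (/ INR (Datatypes.S (g i)))).
                assert (hb := Rmin_r e' (/ INR (Datatypes.S (g i)))).
                fold (coord i x) (coord i y).
                revert hc; apply Rmin_case; lra.
              (* Here coordinate [i] takes a single value, so any radius works. *)
              + exists 1; split; [lra|]; intros y _; apply hST.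
                fold (coord i y); rewrite (Htriv i y x hi); auto. }
          destruct H as [e' [he' h6]]; exists (Rmin e e'); split; [apply Rmin_pos; auto|].
          intros y hy; assert (ha := Rmin_l e e'); assert (hb := Rmin_r e e').
          intros S' [<-|hS']; [apply h6; lra|apply (h5 y); auto; lra]. }
      destruct H as [e [he h]]; exists e; split; auto; intros y hy; apply hU, hlU, h; auto.
    + intros HU.
      (* The ambient open set is the union of all basic boxes whose trace lies in [U]. *)
      exists (fun p => exists l, (forall V, In V l -> prod_subbasis OM OK V) /\
                (forall V, In V l -> V p) /\
                forall y : split_space, (forall V, In V l -> V (proj1_sig y)) -> U y).
      split.
      { intros p (l & h1 & h2 & h3); exists l; split; [auto|split; [auto|]].
        intros q hq; exists l; auto. }
      intros x; split; [|intros (l & _ & h2 & h3); auto].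
      intros hx; destruct (HU x hx) as [e [he hU]].
      destruct (@inv_S_small (e / 2)) as [n hn]; [lra|].
      (* Only the coordinates numbered below [n] need a constraint, at most one per number because
         [g] is injective on [N]; truncation keeps the others below [e / 2]. *)
      assert (H : exists l, (forall V, In V l -> prod_subbasis OM OK V) /\
                (forall V, In V l -> V (proj1_sig x)) /\
                forall y : split_space, (forall V, In V l -> V (proj1_sig y)) ->
                  forall i, N i -> (g i < n)%nat -> d i (coord i x) (coord i y) < e / 2).
      { clear hn; induction n as [|n (l & h1 & h2 & h3)].
        - exists nil; simpl; intuition; lia.
        - destruct (classic (exists i, N i /\ g i = n)) as [[i [hi hgi]]|hno].
          + destruct (Hd i) as [Hm Ho].
            exists ((fun p => d i (coord i x) (snd p i) < e / 2) :: l).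
            split; [|split].
            * intros V [<-|hV]; [|auto]; right.
              exists i, (fun t => d i (coord i x) t < e / 2); split; [|reflexivity].
              apply Ho, ball_open, Hm.
            * intros V [<-|hV]; [|apply h2; auto].
              fold (coord i x); rewrite (proj2 (proj1 (proj2 Hm) _ _) eq_refl); lra.
            * intros y hy j hj hgj.
              destruct (Nat.eq_dec (g j) n) as [hjn|hjn].
              -- assert (j = i) by (apply Hg; auto; congruence); subst j.
                 apply (hy _ (or_introl eq_refl)).
              -- apply h3; auto; [|lia]; intros V hV; apply hy; right; auto.
          + exists l; split; [auto|split; [auto|]]; intros y hy i hi hgi.
            apply h3; auto; assert (g i <> n) by (intros hh; apply hno; eauto); lia. }
      destruct H as (l & h1 & h2 & h3).
      exists ((fun p => dM (base x) (fst p) < e / 2) :: l); split; [|split].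
      * intros V [<-|hV]; [|auto]; left.
        exists (fun m => dM (base x) m < e / 2); split; [|reflexivity].
        apply HOM, ball_open; repeat split; auto; apply M1.
      * intros V [<-|hV]; [|apply h2; auto].
        fold (base x); rewrite (proj2 (M1 _ _) eq_refl); lra.
      (* A supremum of values below [e / 2] may equal [e / 2], whence the halving. *)
      * intros y hy; apply hU, Rle_lt_trans with (e / 2); [|lra].
        apply Dle; [left; apply (hy _ (or_introl eq_refl))|].
        intros i hi; unfold c; destruct (Nat.lt_ge_cases (g i) n) as [h|h].
        -- apply Rle_trans with (1 := Rmin_l _ _); left; apply h3; auto.
           intros V hV; apply hy; right; auto.
        -- apply Rle_trans with (1 := Rmin_r _ _); assert (h' := inv_S_le h); lra.
Qed.

(** * The open colouring of the indices and its homogeneous sets *)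

Definition avoids (p q : R) (i j : I) : Prop := forall h : r i <> r j,
  phi j (f j (exist (fun x => x <> r j) (r i) h)) < p \/
  q < phi j (f j (exist (fun x => x <> r j) (r i) h)).

(** A code [(m, 0)] records the position of [r i], while [(m, 1)] and [(m, 2)] record on which side
    of [[p, q]] the function [phi i] after [f i] stays over [B m]. Larger second components repeat
    the last case. *)
Definition split_bit (B : nat -> M -> Prop) (p q : R) (n : nat) (i : I) : Prop :=
  match of_nat n with
  | (m, 0%nat) => B m (r i)
  | (m, 1%nat) => forall x : {x | x <> r i}, B m (proj1_sig x) -> phi i (f i x) < p
  | (m, _) => forall x : {x | x <> r i}, B m (proj1_sig x) -> q < phi i (f i x)
  end.

(* A base set around [r i] on which [phi j] stays off [[p, q]] witnesses [avoids]
   through one bit of [i] and one bit of [j]. *)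
Lemma avoids_open (B : nat -> M -> Prop) (p q : R) (i j : I) :
  countable_base OM B -> i <> j -> avoids p q i j ->
  exists n, forall i' j', i' <> j' ->
    (forall k, (k <= n)%nat -> (split_bit B p q k i <-> split_bit B p q k i')) ->
    (forall k, (k <= n)%nat -> (split_bit B p q k j <-> split_bit B p q k j')) ->
    avoids p q i' j'.
Proof.
  intros [_ HB] hne hav.
  assert (hr : r i <> r j) by auto.
  assert (H : exists m k, split_bit B p q (to_nat (m, 0%nat)) i /\ (k = 1 \/ k = 2)%nat /\
                split_bit B p q (to_nat (m, k)) j).
  { unfold split_bit; destruct (hav hr) as [h|h].
    - destruct (f_cont j _ (proj1 (phi_cont j p))) as [W [HW hW]].
      destruct (HB W (r i) HW) as [m [hm hm']].
      { apply (hW (exist (fun x => x <> r j) _ hr)); auto. }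
      exists m, 1%nat; rewrite !cancel_of_to; repeat split; auto.
      intros x hb; apply hW, hm'; auto.
    - destruct (f_cont j _ (proj2 (phi_cont j q))) as [W [HW hW]].
      destruct (HB W (r i) HW) as [m [hm hm']].
      { apply (hW (exist (fun x => x <> r j) _ hr)); auto. }
      exists m, 2%nat; rewrite !cancel_of_to; repeat split; auto.
      intros x hb; apply hW, hm'; auto. }
  destruct H as (m & k & h1 & h2 & h3).
  (* The sum bounds both codes, so agreement up to it transfers both bits. *)
  exists (to_nat (m, 0%nat) + to_nat (m, k))%nat; intros i' j' hne' hi' hj' hr'.
  apply hi' in h1; [|lia]; apply hj' in h3; [|lia].
  unfold split_bit in h1, h3; rewrite cancel_of_to in h1, h3.
  destruct h2 as [->| ->]; [left|right]; apply h3; auto.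
Qed.

(** OCA needs a symmetric colour, so [avoids] is required in both directions. The position bits
    alone separate indices, because [r] is injective and points of [M] are closed. *)
Lemma avoids_OCA (N : I -> Prop) (p q : R) :
  OCA -> compact OM -> metrizable OM ->
  (exists A : I -> Prop, (forall i, A i -> N i) /\ ~ countable_on A /\
     forall i j, A i -> A j -> i <> j -> avoids p q i j) \/
  (exists h : I -> nat, forall i j, N i -> N j -> i <> j -> h i = h j ->
     ~ (avoids p q i j /\ avoids p q j i)).
Proof.
  intros HO HMc HMm.
  destruct (compact_metrizable_countable_base HMc HMm) as [B HB].
  destruct (@OCA_second_countable I N (split_bit B p q)
    (fun i j => avoids p q i j /\ avoids p q j i)) as [(A & h1 & h2 & h3)|h]; auto.
  - intros i j _ _ H; apply r_inj, NNPP; intros hne.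
    destruct (proj2 HB _ (r i) (OM_point_closed (r j)) hne) as [m [h1 h2]].
    specialize (H (to_nat (m, 0%nat))); unfold split_bit in H; rewrite cancel_of_to in H.
    apply (h2 (r j)); tauto.
  - tauto.
  - intros i j _ _ hne [hij hji].
    destruct (avoids_open HB hne hij) as [n hn].
    destruct (avoids_open HB (not_eq_sym hne) hji) as [n' hn'].
    exists (n + n')%nat; intros i' j' _ _ hne' hi hj; split.
    + apply hn; auto; intros k hk; [apply hi|apply hj]; lia.
    + apply hn'; auto; intros k hk; [apply hj|apply hi]; lia.
  - left; exists A; split; [auto|split; [auto|]]; intros i j hi hj hne; apply h3; auto.
Qed.

(* [C] is cut out by [phi i] avoiding the gap [(p, q)] for [i] in [A]; the two points
   over [r i] where [phi i] is 0 and 1 differ in the coordinate [i] only. *)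
Lemma split_totally_disconnected_image (A : I -> Prop) (p q : R) :
  0 < p -> p < q -> q < 1 -> compact OM -> (forall i, compact (OK i)) ->
  (forall i, A i -> exists a b, phi i a = 0 /\ phi i b = 1) ->
  ~ countable_on A -> (forall i j, A i -> A j -> i <> j -> avoids p q i j) ->
  exists C : split_space -> Prop,
    closed (split_open r f OM OK) C /\
    exists (Y : Type) (OY : (Y -> Prop) -> Prop),
      topology OY /\ compact OY /\ hausdorff OY /\ ~ metrizable OY /\
      totally_disconnected OY /\
      exists g : {z | C z} -> Y,
        continuous (sub_open (split_open r f OM OK) C) OY g /\ surjective g.
Proof.
  intros hp hpq hq HMc HKc Hab HA Hav.
  pose (C := fun z : split_space =>
          forall i, A i -> phi i (coord i z) <= p \/ q <= phi i (coord i z)).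
  assert (Htop := split_open_topology).
  assert (Hcl : closed (split_open r f OM OK) C).
  { apply open_ext with (1 := top_union Htop
      (fun U => split_open r f OM OK U /\ forall z, U z -> ~ C z) (fun U h => proj1 h)).
    intros z; split.
    - intros [U [[_ h1] h2]]; auto.
    - intros hz.
      assert (H : exists i, A i /\ p < phi i (coord i z) < q).
      { apply NNPP; intros hno; apply hz; intros i hi; apply NNPP; intros h.
        apply hno; exists i; split; auto; lra. }
      destruct H as (i & hi & h).
      exists (fun z => p < phi i (coord i z) /\ phi i (coord i z) < q); split; [|auto].
      split.
      + apply Htop.
        * apply (coord_continuous (proj2 (phi_cont i p))).
        * apply (coord_continuous (proj1 (phi_cont i q))).
      + intros z' h' hC; destruct (hC i hi); lra. }
  exists C; split; auto.
  (* Homogeneity enters here: over [r i], each other coordinate [j] in [A] is forced to be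
     [f j (r i)], whose [phi j]-value lies off [[p, q]]. *)
  assert (Hpt : forall i t, A i -> phi i t <= p \/ q <= phi i t ->
            exists z : {z | C z}, base (proj1_sig z) = r i /\ coord i (proj1_sig z) = t).
  { intros i t hi ht; destruct (split_fiber_point t) as [z [h1 h2]].
    assert (hC : C z).
    { intros j hj; destruct (classic (i = j)) as [<-|hne]; [rewrite h2; auto|].
      assert (hr : base z <> r j) by (rewrite h1; auto).
      rewrite (split_coord z hr); clear h2; revert hr; rewrite h1; intros hr.
      destruct (Hav i j hi hj hne hr); lra. }
    exists (exist _ z hC); auto. }
  apply totally_disconnected_image with
    (A := A) (S := fun i z => p < phi i (coord i (proj1_sig z))); auto.
  - apply sub_open_topology; auto.
  - apply compact_closed_subspace; auto; apply split_compact; auto.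
  - intros i hi; split.
    + exists (fun z => p < phi i (coord i z)); split; [|reflexivity].
      apply (coord_continuous (proj2 (phi_cont i p))).
    (* On [C] no value lies strictly between [p] and [q], so failing [p < phi i] is the open
       condition [phi i < q]. *)
    + exists (fun z => phi i (coord i z) < q); split.
      * apply (coord_continuous (proj1 (phi_cont i q))).
      * intros [z hz]; simpl; destruct (hz i hi); lra.
  - intros i hi; destruct (Hab i hi) as (a & b & ha & hb).
    destruct (Hpt i b hi) as [z1 [h1 h1']]; [lra|].
    destruct (Hpt i a hi) as [z0 [h0 h0']]; [lra|].
    exists z1, z0; rewrite h1', h0'; split; [lra|split; [lra|]].
    (* Both points have base [r i], so their coordinates other than [i] coincide. *)
    intros j hj hne.
    assert (k1 : base (proj1_sig z1) <> r j) by (rewrite h1; auto).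
    assert (k0 : base (proj1_sig z0) <> r j) by (rewrite h0; auto).
    rewrite (split_coord _ k1), (split_coord _ k0); clear h1' h0'.
    revert k1 k0; rewrite h1, h0; intros k1 k0; rewrite (proof_irrelevance _ k1 k0); tauto.
Qed.

End Split.

(** * Combining the colourings for three disjoint intervals *)

Theorem theorem4p7 :
  OCA ->
  forall (I : Type) (enc : I -> (nat -> bool)),
    (forall i j, enc i = enc j -> i = j) ->
  forall (M : Type) (OM : (M -> Prop) -> Prop),
    topology OM -> compact OM -> hausdorff OM -> metrizable OM ->
    no_isolated OM ->
  forall (K : I -> Type) (OK : forall i, (K i -> Prop) -> Prop),
    (forall i, topology (OK i) /\ compact (OK i) /\ hausdorff (OK i) /\
               metrizable (OK i)) ->
  forall (r : I -> M), (forall i j, r i = r j -> i = j) ->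
  forall (f : forall i, {x : M | x <> r i} -> K i),
    (forall i, continuous (sub_open OM (fun x => x <> r i)) (OK i) (f i)) ->
    (forall i (U : M -> Prop), OM U -> U (r i) ->
       dense (OK i) (fun t => exists x : {x : M | x <> r i},
                                U (proj1_sig x) /\ f i x = t)) ->
    ~ metrizable (split_open r f OM OK) ->
    exists C : {p | split_pts r f p} -> Prop,
      closed (split_open r f OM OK) C /\
      exists (Y : Type) (OY : (Y -> Prop) -> Prop),
        topology OY /\ compact OY /\ hausdorff OY /\ ~ metrizable OY /\
        totally_disconnected OY /\
        exists g : {z | C z} -> Y,
          continuous (sub_open (split_open r f OM OK) C) OY g /\ surjective g.
Proof.
  intros HOCA I _ _ M OM HMt HMc HMh HMm _ K OK HK r r_inj f f_cont _ Hnm.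
  assert (HMp := hausdorff_point_complement_open HMt HMh).
  pose (N := fun i => exists a b : K i, a <> b).
  assert (HN : ~ countable_on N).
  { intros hN; apply Hnm, split_metrizable; auto; intros i; apply HK. }
  destruct (dep_choice (fun i => metrizable_separating_function
              (proj2 (proj2 (proj2 (HK i)))))) as [phi Hphi].
  assert (Hphi_cont : forall i, real_continuous (OK i) (phi i)) by (intros i; apply Hphi).
  assert (Hfin : forall p q, 0 < p -> p < q -> q < 1 ->
    (exists A : I -> Prop, (forall i, A i -> N i) /\ ~ countable_on A /\
       forall i j, A i -> A j -> i <> j -> avoids K r f phi p q i j) ->
    exists C : {p | split_pts r f p} -> Prop,
      closed (split_open r f OM OK) C /\
      exists (Y : Type) (OY : (Y -> Prop) -> Prop),
        topology OY /\ compact OY /\ hausdorff OY /\ ~ metrizable OY /\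
        totally_disconnected OY /\
        exists g : {z | C z} -> Y,
          continuous (sub_open (split_open r f OM OK) C) OY g /\ surjective g).
  { intros p q hp hpq hq (A & h1 & h2 & h3).
    apply split_totally_disconnected_image with (phi := phi) (A := A) (p := p) (q := q);
      auto; try (intros i; apply HK).
    intros i hi; apply Hphi, h1, hi. }
  assert (HO := fun p q => avoids_OCA K OK r f r_inj f_cont HMp phi Hphi_cont N p q HOCA HMc HMm).
  (* Sevenths give three disjoint closed intervals inside (0, 1). *)
  destruct (HO (1 / 7) (2 / 7)) as [HA|[u1 H1]]; [apply Hfin with (4 := HA); lra|].
  destruct (HO (3 / 7) (4 / 7)) as [HA|[u2 H2]]; [apply Hfin with (4 := HA); lra|].
  destruct (HO (5 / 7) (6 / 7)) as [HA|[u3 H3]]; [apply Hfin with (4 := HA); lra|].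
  (* Equal codes mean lying in a common piece of all three covers, which must force equality of
     indices. *)
  destruct HN; exists (fun i => to_nat (u1 i, to_nat (u2 i, u3 i))).
  intros i j hi hj hu; apply NNPP; intros hne.
  apply to_nat_inj, pair_equal_spec in hu; destruct hu as [e1 e2].
  apply to_nat_inj, pair_equal_spec in e2; destruct e2 as [e2 e3].
  specialize (H1 i j hi hj hne e1); specialize (H2 i j hi hj hne e2).
  specialize (H3 i j hi hj hne e3).
  assert (hij : r i <> r j) by auto; assert (hji : r j <> r i) by auto.
  pose (x := phi j (f j (exist (fun x => x <> r j) (r i) hij))).
  pose (y := phi i (f i (exist (fun x => x <> r i) (r j) hji))).
  (* The two values cannot meet three disjoint intervals. *)
  assert (Hxy : forall p q, ~ (avoids K r f phi p q i j /\ avoids K r f phi p q j i) ->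
                  p <= x <= q \/ p <= y <= q).
  { intros p q h; apply NNPP; intros hno; apply h; split; intros k.
    - rewrite (proof_irrelevance _ k hij); fold x; lra.
    - rewrite (proof_irrelevance _ k hji); fold y; lra. }
  apply Hxy in H1, H2, H3; lra.
Qed.
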